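(* Let $\varepsilon_*:=\frac{4-\sqrt{13}}{3}$. If $\varepsilon_*<\varepsilon\le\frac13$, then $G^3_{AP}(C_\varepsilon)$ contains no interval of the form $(0,r)$ with $r>0$. Moreover, if $\varepsilon_*<\varepsilon\le3-2\sqrt2$ and $\lambda=(1-\varepsilon)/2$ (equivalently $\sqrt2-1\le\lambda<\frac{\sqrt{13}-1}{6}$), then for every integer $n\ge0$, $$\left(\lambda^{n+2},\ \frac{1-\lambda-\lambda^2}{2}\,\lambda^n\right)\cap G^3_{AP}(C_\varepsilon)=\varnothing.$$
   Context: For $0<\varepsilon<1$ put $\lambda=(1-\varepsilon)/2$. The middle-$\varepsilon$ Cantor set $C_\varepsilon\subset[0,1]$ is the attractor of $f_0(x)=\lambda x$ and $f_1(x)=1-\lambda+\lambda x$, i.e. the unique nonempty compact set with $C_\varepsilon=f_0(C_\varepsilon)\cup f_1(C_\varepsilon)$. For compact $C\subset\mathbb R$, $G^3_{AP}(C):=\{t>0:\exists x\in\mathbb R\text{ with }x,x+t,x+2t\in C\}$. *)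

(* Defs.v *)
From HB Require Import structures.
From mathcomp Require Import all_boot all_order all_algebra.
From mathcomp Require Import ring lra.
From mathcomp Require Import all_classical all_reals all_analysis.

Set Implicit Arguments.
Unset Strict Implicit.
Unset Printing Implicit Defensive.

Import Order.TTheory GRing.Theory Num.Theory.
Import numFieldNormedType.Exports.

Local Open Scope classical_set_scope.
Local Open Scope ring_scope.

Definition lam (R : realType) (eps : R) : R := (1 - eps) / 2.

Definition f0 (R : realType) (l x : R) : R := l * x.
Definition f1 (R : realType) (l x : R) : R := 1 - l + l * x.

Definition is_attractor (R : realType) (l : R) (C : set R) : Prop :=
  [/\ compact C, C !=set0 & C = (f0 l @` C) `|` (f1 l @` C)].

(* The default value [set0] of [xget] is never used for 0 < eps < 1: existence
   and uniqueness of the attractor are [cantorP] and [cantor_unique]. *)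
Definition cantor (R : realType) (eps : R) : set R :=
  xget set0 (is_attractor (lam eps)).

Definition G3AP (R : realType) (C : set R) : set R :=
  [set t | 0 < t /\ exists x : R, [/\ C x, C (x + t) & C (x + 2 * t)]].

Definition eps_star (R : realType) : R := (4 - Num.sqrt 13) / 3.

Fixpoint cantor_approx (R : realType) (l : R) (n : nat) : set R :=
  if n is m.+1 then
    (f0 l @` cantor_approx l m) `|` (f1 l @` cantor_approx l m)
  else [set` `[0 : R, 1]].

Lemma continuous_f0 (R : realType) (l : R) : continuous (f0 l).
Proof. by move=> x; apply: cvgM; [exact: cvg_cst|exact: cvg_id]. Qed.

Lemma continuous_f1 (R : realType) (l : R) : continuous (f1 l).
Proof. by move=> x; apply: cvgD; [exact: cvg_cst|exact: continuous_f0]. Qed.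

Lemma compact_cantor_approx (R : realType) (l : R) n :
  compact (cantor_approx l n).
Proof.
elim: n => [|n IHn] /=; first exact: segment_compact.
apply: compactU; apply: continuous_compact => //;
  apply: continuous_subspaceT; [exact: continuous_f0|exact: continuous_f1].
Qed.

Lemma cantor_approxS (R : realType) (l : R) n : 0 <= l <= 1 ->
  cantor_approx l n.+1 `<=` cantor_approx l n.
Proof.
move=> /andP[l0 l1]; elim: n => [|n IHn] x /=.
  by case=> -[y]; rewrite /= in_itv /= => /andP[y0 y1] <-;
    rewrite in_itv /= /f0 /f1; apply/andP; split; nra.
case=> -[y /IHn Ey <-]; [left|right]; exact: imageP.
Qed.

Lemma cantor_approx_sub (R : realType) (l : R) n : 0 <= l <= 1 ->
  cantor_approx l n `<=` [set` `[0 : R, 1]].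
Proof.
by move=> l01; elim: n => [//|n IHn] x /(cantor_approxS l01) /IHn.
Qed.

Lemma attractor_exists (R : realType) (l : R) : 0 < l < 1 / 2 ->
  exists C, is_attractor l C.
Proof.
move=> /andP[l0 l12].
have l01 : 0 <= l <= 1 by lra.
exists (\bigcap_n cantor_approx l n); split.
- apply: (subclosed_compact _ (@compact_cantor_approx R l 0)).
    apply: closed_bigI => n _; apply: compact_closed.
      exact: norm_hausdorff.
    exact: compact_cantor_approx.
  by move=> x; apply.
- exists 0 => n _; elim: n => [|n IHn] /=.
    by rewrite in_itv /= lexx ler01.
  by left; exists 0 => //; rewrite /f0 mulr0.
- apply/seteqP; split => x.
    move=> Dx; have /= := Dx 1%N I.
    case=> -[y y01 yx]; move: (y01); rewrite /= in_itv /= => /andP[y0 y1].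
      left; exists y => // n _.
      have /= := Dx n.+1 I; case=> -[z Ez zx].
        suff -> : y = z by [].
        by apply: (mulfI (lt0r_neq0 l0)); move: yx zx; rewrite /f0 => -> ->.
      have /= := cantor_approx_sub l01 Ez; rewrite in_itv /= => /andP[z0 z1].
      by exfalso; move: yx zx; rewrite /f0 /f1 => <- ?; nra.
    right; exists y => // n _.
    have /= := Dx n.+1 I; case=> -[z Ez zx].
      have /= := cantor_approx_sub l01 Ez; rewrite in_itv /= => /andP[z0 z1].
      by exfalso; move: yx zx; rewrite /f0 /f1 => <- ?; nra.
    suff -> : y = z by [].
    apply: (mulfI (lt0r_neq0 l0)); move: yx zx.
    by rewrite /f1 => <- /addrI.
  move=> xD n _; apply: (cantor_approxS l01).
  by case: xD => -[y Dy <-]; [left|right]; apply: imageP; apply: Dy.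
Qed.

Lemma attractor_sub (R : realType) (l : R) (K L : set R) : 0 < l < 1 ->
  is_attractor l K -> is_attractor l L -> K `<=` L.
Proof.
move=> /andP[l0 l1] [cK _ eK] [cL [b Lb] eL].
have [A [_ KA]] := compact_bounded cK.
pose M := A + 1 + `|b|.
have approx n x : K x -> exists2 y, L y & `|x - y| <= M * l ^+ n.
  elim: n x => [|n IHn] x Kx.
    exists b => //; rewrite expr0 mulr1 (le_trans (ler_normB _ _))//.
    by rewrite lerD2r; apply: (KA (A + 1)) => //; rewrite ltrDl.
  move: Kx; rewrite eK => -[] [x' /IHn[y Ly xy] <-].
    exists (f0 l y); first by rewrite eL; left; exact: imageP.
    have -> : f0 l x' - f0 l y = l * (x' - y) by rewrite /f0; ring.
    by rewrite normrM (gtr0_norm l0) exprS mulrCA ler_wpM2l// ltW.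
  exists (f1 l y); first by rewrite eL; right; exact: imageP.
  have -> : f1 l x' - f1 l y = l * (x' - y) by rewrite /f1; ring.
  by rewrite normrM (gtr0_norm l0) exprS mulrCA ler_wpM2l// ltW.
move=> x Kx.
have /closure_id -> : closed L by exact: compact_closed (@norm_hausdorff _ _) cL.
move=> B /nbhs_ballP[e /= e0 xB].
have : geometric M l @ \oo --> 0 by apply: cvg_geometric; rewrite gtr0_norm.
move=> /cvgrPdist_lt/(_ e e0)[n _ /(_ n (leqnn n))] /=.
rewrite sub0r normrN => Me.
have [y Ly xy] := approx n x Kx.
exists y; split => //; apply: xB; rewrite /ball /=.
exact: le_lt_trans xy (le_lt_trans (ler_norm _) Me).
Qed.

Lemma cantorP (R : realType) (eps : R) : 0 < eps < 1 ->
  is_attractor (lam eps) (cantor eps).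
Proof.
move=> eps01; apply: xgetPex; apply: attractor_exists.
by rewrite /lam; lra.
Qed.

Lemma cantor_unique (R : realType) (eps : R) (C : set R) : 0 < eps < 1 ->
  is_attractor (lam eps) C -> C = cantor eps.
Proof.
move=> eps01 aC; have aD := cantorP eps01.
have l01 : 0 < lam eps < 1 by rewrite /lam; lra.
by apply/seteqP; split; exact: (attractor_sub l01).
Qed.

(* Main.v *)
(* A progression x, x+t, x+2t in C either lies in one of the two pieces f_0(C),
   f_1(C), and then t/l is again a difference for C, or it straddles the central
   hole.  In the second case t is at least the length 1-2l of the hole, and two
   consecutive terms share a first-level piece, so t <= l.  If moreover t > l^2,
   these two terms lie in distinct second-level pieces, which leaves
   2t >= 1-l-l^2.  So there is a gap starting at l^2: it ends at 1-2l when
   l < sqrt 2 - 1, and at (1-l-l^2)/2 when 3l^2+l < 1.  The first dichotomy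
   reproduces it at every scale l^n. *)

Require Import Defs.
From HB Require Import structures.
From mathcomp Require Import all_boot all_order all_algebra.
From mathcomp Require Import lra.
From mathcomp Require Import all_classical all_reals all_analysis.

Set Implicit Arguments.
Unset Strict Implicit.

Import Order.TTheory GRing.Theory Num.Theory.
Import numFieldNormedType.Exports.

Local Open Scope classical_set_scope.
Local Open Scope ring_scope.

Lemma attractor_cases (R : realType) (l : R) (C : set R) (x : R) :
  is_attractor l C -> C x ->
  exists2 y, C y & x = l * y \/ x = 1 - l + l * y.
Proof.
by case=> _ _ eC; rewrite {1}eC => -[] [y Cy <-]; exists y => //; [left|right].
Qed.

Lemma attractor_ge0_le1 (R : realType) (l : R) (C : set R) (x : R) :
  0 < l < 1 -> is_attractor l C -> C x -> 0 <= x <= 1.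
Proof.
move=> /andP[l0 l1] attrC Cx; have [cC C0 _] := attrC.
pose D := [set `|y - 1 / 2| | y in C].
have D0 : D !=set0 by case: C0 => y Cy; exists `|y - 1 / 2|, y.
have [A [_ CA]] := compact_bounded cC.
have supD : has_sup D.
  split=> //; exists (A + 1 + 1 / 2) => _ [y Cy <-].
  have : `|y| <= A + 1 by apply: (CA (A + 1)) => //; rewrite ltrDl.
  by rewrite !ler_norml => /andP[? ?]; apply/andP; split; lra.
have Dsup y : C y -> `|y - 1 / 2| <= sup D.
  by move=> Cy; apply: ub_le_sup; [case: supD|exists y].
(* Both maps send the distance u to 1/2 to at most l u + (1 - l)/2, whose
   fixed point is 1/2. *)
have : sup D <= l * sup D + (1 - l) / 2.
  apply: ge_sup => // _ [y Cy <-].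
  have [z /Dsup] := attractor_cases attrC Cy.
  by rewrite !ler_norml => /andP[? ?] [] ->; apply/andP; split; nra.
move=> supD_le; have : sup D <= 1 / 2 by nra.
by have := Dsup _ Cx; rewrite ler_norml => /andP[? ?] ?; lra.
Qed.

Section gaps.
Variables (R : realType) (l : R) (C : set R).
Hypotheses (l_gt0 : 0 < l) (l_lt12 : l < 1 / 2) (attrC : is_attractor l C).

Let C01 x : C x -> 0 <= x <= 1.
Proof.
by apply: (attractor_ge0_le1 _ attrC); rewrite l_gt0 (lt_trans l_lt12)//; lra.
Qed.

Let lC x : C x -> 0 <= l * x <= l.
Proof.
by move=> /C01/andP[x0 x1]; rewrite mulr_ge0 ?(ltW l_gt0)//= ler_piMr// ltW.
Qed.

(** Each first-level piece has length [l], so points more than [l] apart lie in different pieces,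
    the smaller one on the left. *)
Let far_apart y z : C y -> C z -> l < z - y -> y <= l /\ 1 - l <= z.
Proof.
(* [lra] and [nra] do not see section hypotheses, hence the local copies. *)
move: (l_gt0) (l_lt12) => l0 l12 Cy Cz; have := C01 Cy; have := C01 Cz.
have [y' /lC ?] := attractor_cases attrC Cy.
have [z' /lC ?] := attractor_cases attrC Cz.
by move=> [] -> [] -> ? ? ?; split; lra.
Qed.

Lemma G3AP_attractor_cases (t : R) : G3AP C t ->
  G3AP C (t / l) \/
  [/\ 1 - 2 * l <= t, t <= l & l ^+ 2 < t -> 1 - l - l ^+ 2 <= 2 * t].
Proof.
move: (l_gt0) (l_lt12) => l0 l12.
case=> t0 [x [Cx Cxt Cx2t]].
have [a Ca xE] := attractor_cases attrC Cx.
have [b Cb xtE] := attractor_cases attrC Cxt.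
have [c Cc x2tE] := attractor_cases attrC Cx2t.
have := lC Ca; have := lC Cb; have := lC Cc => lc lb la.
have l_neq0 : l != 0 by rewrite gt_eqF.
have one_piece : t = l * (b - a) -> 2 * t = l * (c - a) -> G3AP C (t / l).
  move=> tb tc; have tl : t / l = b - a by rewrite tb mulrAC divff ?mul1r.
  have tl2 : 2 * (t / l) = c - a by rewrite mulrA tc mulrAC divff ?mul1r.
  split; first by rewrite divr_gt0.
  by exists a; rewrite tl2 tl !(addrC a) !subrK.
(* As the terms increase, only the piece patterns 000, 001, 011 and 111 survive. *)
case: xE xtE x2tE => xE [] xtE [] x2tE; try by (exfalso; lra).
- by left; apply: one_piece; lra.
- right; split; [lra|lra|move=> lt].
  (* Dividing [l ^+ 2 < t] by [l] gives [l < b - a]; hence [x <= l ^+ 2], while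
     [x + 2 * t >= 1 - l]. *)
  have [] := far_apart Ca Cb; first by rewrite -(ltr_pM2l l_gt0); lra.
  by move=> ? ?; nra.
- right; split; [lra|lra|move=> lt].
  (* Mirror image: [x <= l] and [x + 2 * t >= 1 - l ^+ 2]. *)
  have [] := far_apart Cb Cc; first by rewrite -(ltr_pM2l l_gt0); lra.
  by move=> ? ?; nra.
- by left; apply: one_piece; lra.
Qed.

Lemma G3AP_attractor_le (t : R) : G3AP C t -> t <= l.
Proof.
move: (l_gt0) (l_lt12) => l0 l12 /G3AP_attractor_cases[[_ [x [/C01 ? _ /C01 ?]]]|[]//].
have : t / l <= 1 / 2 by lra.
by rewrite ler_pdivrMr//; lra.
Qed.

(** The alternative on [d] excludes straddling progressions when [n] is 0; [d * l <= 1 - 2 * l]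
    excludes them at all smaller scales, where [t] stays below the length of the hole. *)
Lemma G3AP_attractor_gap (d : R) (n : nat) :
  d <= 1 - 2 * l \/ 2 * d <= 1 - l - l ^+ 2 -> d * l <= 1 - 2 * l ->
  forall t, l ^+ n.+2 < t -> t < d * l ^+ n -> ~ G3AP C t.
Proof.
move: (l_gt0) (l_lt12) => l0 l12 hd dl; elim: n => [|n IHn] t lt td Gt.
  (* Inside one piece, [t / l] would be a difference exceeding the bound [l]. *)
  have [/G3AP_attractor_le|[? ? h]] := G3AP_attractor_cases Gt.
    by rewrite ler_pdivrMr//; lra.
  by have := h lt; lra.
have [|[t_ge _ _]] := G3AP_attractor_cases Gt.
  apply: IHn; first by rewrite ltr_pdivlMr// -exprSr.
  by rewrite ltr_pdivrMr// -mulrA -exprSr.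
have ln0 : 0 < l ^+ n by rewrite exprn_gt0.
have ln1 : l ^+ n <= 1 by rewrite exprn_ile1//; lra.
by move: td; rewrite exprS mulrA => td; nra.
Qed.

(** The gaps are nonempty because [l ^+ 2 < d], and they shrink to 0, so the midpoint of one of them
    lies in []0, r[]. *)
Lemma no_interval_in_G3AP (d r : R) :
  l ^+ 2 < d -> d <= 1 - 2 * l \/ 2 * d <= 1 - l - l ^+ 2 ->
  d * l <= 1 - 2 * l -> 0 < r -> ~ [set` `]0 : R, r[] `<=` G3AP C.
Proof.
move: (l_gt0) (l_lt12) => l0 l12 ld hd dl r0 sub.
have : geometric d l @ \oo --> 0.
  by apply: cvg_geometric; rewrite gtr0_norm//; lra.
move=> /cvgrPdist_lt/(_ r r0)[n _ /(_ n (leqnn n))] /=.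
rewrite sub0r normrN => /(le_lt_trans (ler_norm _)) dn.
have ln0 : 0 < l ^+ n by rewrite exprn_gt0.
have l2n : l ^+ n.+2 < d * l ^+ n by rewrite -addn2 addnC exprD ltr_pM2r.
have l2n0 : 0 < l ^+ n.+2 by rewrite exprn_gt0.
apply: (@G3AP_attractor_gap d n hd dl ((l ^+ n.+2 + d * l ^+ n) / 2)).
- by rewrite midf_lt.
- by rewrite midf_lt.
- by apply: sub; rewrite /= in_itv /=; apply/andP; split; lra.
Qed.

End gaps.

(** At [eps_star], [lam] equals (sqrt 13 - 1)/6, the positive root of 3 l^2 + l = 1. *)
Lemma eps_star_lt (R : realType) (eps : R) : eps_star R < eps -> eps < 1 ->
  [/\ 0 < eps, 0 < lam eps, lam eps < 1 / 2 &
      3 * lam eps ^+ 2 + lam eps < 1].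
Proof.
rewrite /eps_star /lam => e e1; have s0 : 0 <= Num.sqrt (13 : R) := sqrtr_ge0 _.
have s2 : Num.sqrt (13 : R) ^+ 2 = 13 by rewrite sqr_sqrtr.
have s4 : Num.sqrt (13 : R) < 4 by nra.
have e0 : 0 < eps by lra.
by split; [lra|lra|lra|nra].
Qed.

Theorem theorem3p9 (R : realType) (eps : R) :
  [/\ eps_star R < eps <= 1 / 3 ->
        ~ exists r : R, 0 < r /\ [set` `]0 : R, r[] `<=` G3AP (cantor eps),
      eps_star R < eps <= 3 - 2 * Num.sqrt 2 <->
        Num.sqrt 2 - 1 <= lam eps < (Num.sqrt 13 - 1) / 6 &
      eps_star R < eps <= 3 - 2 * Num.sqrt 2 ->
        forall n : nat,
          [set` `]lam eps ^+ n.+2, (1 - lam eps - lam eps ^+ 2) / 2 * lam eps ^+ n[]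
            `&` G3AP (cantor eps) = set0].
Proof.
have second_gap_scale (l : R) : 0 < l -> 3 * l ^+ 2 + l < 1 ->
    (1 - l - l ^+ 2) / 2 * l <= 1 - 2 * l.
  (* [9 / 20] lies just above that root; expanding the square bounds [l ^+ 3] from below, which
     leaves a quadratic inequality. *)
  move=> l0 l3; have l45 : l < 9 / 20 by nra.
  have sq : 0 <= (l - 9 / 20) ^+ 2 by rewrite sqr_ge0.
  have := mulr_ge0 (ltW l0) sq; nra.
split.
- move=> /andP[e e13] [r [r0 sub]].
  have [|e0 l0 l12 l3] := eps_star_lt e; first lra.
  have attrC : is_attractor (lam eps) (cantor eps) by apply: cantorP; lra.
  set l := lam eps in l0 l12 l3 attrC *.
  (* The threshold is l = sqrt 2 - 1; below it, [d] is the hole length [1 - 2 * l]. *)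
  have [l2|l2] := ltP (l ^+ 2) (1 - 2 * l).
    by apply: (no_interval_in_G3AP l0 l12 attrC l2 _ _ r0 sub); [left|nra].
  apply: (no_interval_in_G3AP (d := (1 - l - l ^+ 2) / 2) l0 l12 attrC _ _ _ r0 sub).
  + by lra.
  + by right; lra.
  + exact: second_gap_scale.
- by rewrite /eps_star /lam; split => /andP[? ?]; apply/andP; split; lra.
- move=> /andP[e e2] n.
  have s2 : 1 <= Num.sqrt (2 : R) by rewrite -[leLHS]sqrtr1 ler_wsqrtr//; lra.
  have [|e0 l0 l12 l3] := eps_star_lt e.
    have : Num.sqrt (2 : R) ^+ 2 = 2 by rewrite sqr_sqrtr.
    by nra.
  have attrC : is_attractor (lam eps) (cantor eps).
    apply: cantorP; rewrite e0 /=; move: l0; rewrite /lam; lra.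
  rewrite -subset0 => t [/=]; rewrite in_itv /= => /andP[lt td].
  apply: (G3AP_attractor_gap l0 l12 attrC _ _ lt td).
  + by right; lra.
  + exact: second_gap_scale.
Qed.
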